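(* Let $X$ be a Banach space. There exists a sequence $\{c_i\}_{i\ge2}$ of real numbers such that for any function $u\in C^{2p+3}([0,T],X)$, where $p$ is a positive integer, and a partition $0=t_0<t_1<\dots<t_N=T$, $t_n=nk$, of $[0,T]$, we have $$u'(t_{n+1/2})=\frac{u(t_{n+1})-u(t_n)}{k}-\sum_{i=1}^pc_{2i+1}k^{2i}D(D_+D_-)^iu(t_{n+1/2})+O(k^{2p+2}),$$ and $$u(t_{n+1/2})=\frac{u(t_{n+1})+u(t_n)}{2}-\sum_{i=1}^pc_{2i}k^{2i}(D_+D_-)^iEu(t_{n+1/2})+O(k^{2p+2}),$$ for $p\le n\le N-1-p$. The error constants for these two formulae are, respectively, $c_{2p+3}$ and $c_{2p+2}$. The first ten coefficients are $$c_2=\tfrac18,\quad c_3=\tfrac1{24},\quad c_4=-\tfrac{18}{4!\,2^5},\quad c_5=-\tfrac{18}{5!\,2^5},\quad c_6=\tfrac{450}{6!\,2^7},\quad c_7=\tfrac{450}{7!\,2^7},$$ $$c_8=-\tfrac{22050}{8!\,2^9},\quad c_9=-\tfrac{22050}{9!\,2^9},\quad c_{10}=\tfrac{1786050}{10!\,2^{11}},\quad c_{11}=\tfrac{1786050}{11!\,2^{11}}.$$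
   Context: Notation: $k>0$ is the spacing, $t_n=nk$, $t_{n+1/2}=(n+1/2)k$. $D_+v(t_n)=\frac{v(t_{n+1})-v(t_n)}{k}$, $D_-v(t_n)=\frac{v(t_n)-v(t_{n-1})}{k}$, $Dv(t_{n+1/2})=\frac{v(t_{n+1})-v(t_n)}{k}$, $Ev(t_{n+1/2})=\frac{v(t_{n+1})+v(t_n)}{2}$; composites are defined recursively, and $D(D_+D_-)^iu(t_{n+1/2})$ and $(D_+D_-)^iEu(t_{n+1/2})$ mean $D$, respectively $E$, applied to $v=(D_+D_-)^iu$. The constants implied in $O(\cdot)$ (as $k\to0$) may depend on $u$ and $p$ but not on $k$ or $n$. The error constant of an approximation formula for a function value or derivative of $u$ at a point $s$, with remainder (exact value minus approximation) $O(k^{q})$, is the number $C$, considered up to sign, such that the remainder equals $\pm C k^{q}u^{(r)}(s)+o(k^{q})$ as $k\to 0$, uniformly in $n$, with a fixed sign; here $q=2p+2$, $s=t_{n+1/2}$, and $r=2p+3$ for the first formula and $r=2p+2$ for the second. *)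

(* Defs.v *)
From HB Require Import structures.
From mathcomp Require Import all_boot all_order all_algebra.
From mathcomp Require Import all_classical all_reals all_analysis.

Set Implicit Arguments.
Unset Strict Implicit.
Unset Printing Implicit Defensive.

Import Order.TTheory GRing.Theory Num.Theory.
Import numFieldNormedType.Exports.

Local Open Scope classical_set_scope.
Local Open Scope ring_scope.

Section derivatives_on_a_set.
Context {R : realType} {X : normedModType R}.
Implicit Types (A : set R) (v : R -> X).

(* Difference quotients are only taken between points of A, so that at an
   endpoint of a closed interval the derivative is the one-sided one.  At an
   interior point of A this is the library's derivative (derive_onE). *)
Definition derivable_on A v (a : R) : Prop :=
  cvg (h^-1 *: (v (h + a) - v a) @[h --> within [set h | A (h + a)] 0^']).

Definition derive_on A v (a : R) : X :=
  lim (h^-1 *: (v (h + a) - v a) @[h --> within [set h | A (h + a)] 0^']).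

Definition derive_onn (r : nat) A v : R -> X := iter r (derive_on A) v.

(* v is in C^m([0, T], X); only the restriction of v to [0, T] matters. *)
Definition continuously_derivable (m : nat) (T : R) v : Prop :=
  (forall j a, (j < m)%N -> a \in `[0, T] ->
     derivable_on `[0, T] (derive_onn j `[0, T] v) a) /\
  {within `[0, T], continuous (derive_onn m `[0, T] v)}.

Lemma derive_onE A v a : A° a -> derive_on A v a = v^`()%classic a.
Proof.
move=> Aa; rewrite /derive_on /derive1; congr (lim (_ @ _)).
suff nA : \forall h \near (0 : R)^', A (h + a).
  apply/seteqP; split => P; rewrite /within /=; last first.
    by apply: filterS => h Ph _.
  by move=> nP; near=> h; apply: (near nP h) => //; near: h.
apply: (@cvg_within _ (nbhs (0 : R))).
have /= := @cvgD R R _ (nbhs (0 : R)) _ id (cst a) 0 a cvg_id (cvg_cst a).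
by rewrite add0r; apply.
Unshelve. all: by end_near. Qed.

End derivatives_on_a_set.

Section grid.
Context {R : realType}.

Definition t_ (k : R) (n : nat) : R := n%:R * k.

Definition t_half (k : R) (n : nat) : R := (n%:R + 2^-1) * k.

(* P holds for all small enough spacings k for which T is a multiple N k of k,
   uniformly over the indices p <= n <= N - 1 - p. *)
Definition near_grids (p : nat) (T : R) (P : R -> nat -> Prop) : Prop :=
  \forall k \near (0 : R)^'+, forall N n : nat,
    t_ k N = T -> (p <= n)%N -> (n + p + 1 <= N)%N -> P k n.

Context {X : normedModType R}.

Definition grid_bigO (p : nat) (T : R) (q : nat) (e : R -> nat -> X) : Prop :=
  exists M : R, near_grids p T (fun k n => `|e k n| <= M * k ^+ q).

Definition grid_littleo (p : nat) (T : R) (q : nat) (e : R -> nat -> X) : Prop :=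
  forall eps : R, 0 < eps ->
    near_grids p T (fun k n => `|e k n| <= eps * k ^+ q).

End grid.

Section differences.
Context {R : realType} {X : normedModType R}.
Implicit Types (k s : R) (v : R -> X).

Definition Dplus k v s : X := k^-1 *: (v (s + k) - v s).
Definition Dminus k v s : X := k^-1 *: (v s - v (s - k)).

(* D and E are meant to be evaluated at the midpoints s = t_(n+1/2), where
   s + k / 2 = t_(n+1) and s - k / 2 = t_n. *)
Definition Dmid k v s : X := k^-1 *: (v (s + k / 2) - v (s - k / 2)).
Definition Emid k v s : X := 2^-1 *: (v (s + k / 2) + v (s - k / 2)).

Definition DpDm (i : nat) k v : R -> X := iter i (fun w => Dplus k (Dminus k w)) v.

Definition rem_derivative (c : nat -> R) (p : nat) (T : R) v k (n : nat) : X :=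
  derive_on `[0, T] v (t_half k n) -
  (k^-1 *: (v (t_ k n.+1) - v (t_ k n)) -
   \sum_(1 <= i < p.+1)
     (c (2 * i + 1)%N * k ^+ (2 * i)) *: Dmid k (DpDm i k v) (t_half k n)).

Definition rem_value (c : nat -> R) (p : nat) (T : R) v k (n : nat) : X :=
  v (t_half k n) -
  (2^-1 *: (v (t_ k n.+1) + v (t_ k n)) -
   \sum_(1 <= i < p.+1)
     (c (2 * i)%N * k ^+ (2 * i)) *: Emid k (DpDm i k v) (t_half k n)).

(* C is the error constant of an approximation formula of order q whose
   remainder is rem, applied to functions of class C^m: for a fixed sign,
   common to all T and u, the remainder is
   +/- C k^q u^(r)(t_(n+1/2)) + o(k^q), uniformly in n. *)
Definition is_error_constant (p q r m : nat)
    (rem : R -> (R -> X) -> R -> nat -> X) (C : R) : Prop :=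
  exists sg : bool, forall (T : R) (u : R -> X),
    0 < T -> continuously_derivable m T u ->
    grid_littleo p T q (fun k n =>
      rem T u k n -
      ((-1) ^+ sg * C * k ^+ q) *: derive_onn r `[0, T] u (t_half k n)).

End differences.

(* Main.v *)
Require Import Defs.
From mathcomp Require Import all_boot all_order all_algebra.
From mathcomp Require Import all_classical all_reals all_analysis.
From mathcomp Require Import zify ring lra.

Import Order.TTheory GRing.Theory Num.Theory.
Import numFieldNormedType.Exports.

Local Open Scope classical_set_scope.
Local Open Scope ring_scope.

(* Put V(y) = u(t_(n+1/2) + k y), let delta and mu be the central difference
   and mean with unit step, and let b = 1 for the derivative formula and b = 0
   for the value formula.  Then k^b times the remainder is V^(b)(0) plus a fixed
   linear combination of delta^(2i+1) V(0), resp. mu delta^(2i) V(0).  A Taylor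
   expansion of V, whose error is uniform in n because the last derivative of u
   is uniformly continuous on [0, T], reduces everything to the values of this
   functional on monomials.  These are read off two monic polynomial bases: with
     q_n(x) = prod_(1 <= i <= n) (x + (n+1)/2 - i),  r_0 = 1,  r_(n+1) = x q_n,
   one has delta q_n = n q_(n-1), delta r_n = n r_(n-1), mu q_n = r_n and
   r_n(0) = 0 for n > 0, so each basis element meets at most one term of the
   combination, and asking that the functional vanish determines the c_n:
   c_(2l) = - q_(2l)(0) / (2l)! and c_(2l+1) = - q_(2l)(0) / (2l+1)!. *)

(** * Central factorial polynomials: half-step shifts, parity, degree *)

Section central_factorials.
Context {R : realType}.

(** The polynomial q_n: its n roots have unit spacing and lie symmetrically about 0. *)
Definition cfact (n : nat) : {poly R} :=
  \prod_(i < n) ('X - (i.+1%:R - n.+1%:R / 2)%:P).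

Lemma horner_cfact n y :
  (cfact n).[y] = \prod_(i < n) (y - (i.+1%:R - n.+1%:R / 2)).
Proof. by rewrite horner_prod; apply: eq_bigr => i _; rewrite hornerXsubC. Qed.

(** The half shift moves the roots of q_(n+1) to those of q_n and one more, -(n+1)/2, which is split
    off as the first factor. For the opposite shift the extra root is (n+1)/2 and comes from the
    last factor. *)
Lemma cfactS_plus n y :
  (cfact n.+1).[y + 2^-1] = (y + n.+1%:R / 2) * (cfact n).[y].
Proof.
rewrite !horner_cfact big_ord_recl; congr (_ * _); first by rewrite /=; field.
by apply: eq_bigr => i _; rewrite lift0; field.
Qed.

Lemma cfactS_minus n y :
  (cfact n.+1).[y - 2^-1] = (y - n.+1%:R / 2) * (cfact n).[y].
Proof.
rewrite !horner_cfact big_ord_recr [LHS]mulrC /=; congr (_ * _); first by field.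
by apply: eq_bigr => i _; field.
Qed.

(** Writing 0 = -1/2 + 1/2 and -1/2 = 0 - 1/2, each half shift releases one linear factor. *)
Lemma cfactSS_0 n : (cfact n.+2).[0] = - (n.+1%:R / 2) ^+ 2 * (cfact n).[0].
Proof.
rewrite -[X in _.[X]](addNr 2^-1) cfactS_plus -[X in _.[X]]add0r cfactS_minus.
by field.
Qed.

Lemma cfact_odd_0 n : odd n -> (cfact n).[0] = 0.
Proof.
elim/ltn_ind: n => -[|[|n]] IH //=.
  by rewrite horner_cfact big_ord1 /= => _; field.
by rewrite negbK => on; rewrite cfactSS_0 IH// mulr0.
Qed.

Lemma cfact_monic n : cfact n \is monic.
Proof. exact: monic_prod_XsubC. Qed.

Lemma size_cfact n : size (cfact n) = n.+1.
Proof.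
by rewrite size_prod_XsubC [index_enum _]unlock -enumT size_enum_ord.
Qed.

Definition cfactX (n : nat) : {poly R} := if n is m.+1 then 'X * cfact m else 1.

Lemma cfactX_monic n : cfactX n \is monic.
Proof. by case: n => [|n]; rewrite ?monic1// monicMl ?monicX// cfact_monic. Qed.

Lemma size_cfactX n : size (cfactX n) = n.+1.
Proof.
case: n => [|n]; first exact: size_poly1.
by rewrite /cfactX mulrC size_mulX ?size_cfact// monic_neq0// cfact_monic.
Qed.

End central_factorials.

(** * Central difference and mean on the two polynomial bases *)

Section central_differences.
Context {R : realType}.

(** The module [W] is left general because the operators act both on real polynomials and on
    functions with values in [X]. *)
Definition cdiff {W : lmodType R} (V : R -> W) (y : R) : W :=
  V (y + 2^-1) - V (y - 2^-1).

Definition cmean {W : lmodType R} (V : R -> W) (y : R) : W :=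
  2^-1 *: (V (y + 2^-1) + V (y - 2^-1)).

(** The two shifted values share the factor q_(n-1), and their linear factors differ by n. The
    equality is between functions so that it can be iterated. *)
Lemma cdiff_cfact n :
  cdiff (fun y => (cfact n).[y]) = (fun y => n%:R * (cfact n.-1).[y] : R).
Proof.
apply/funext => y; rewrite /cdiff; case: n => [|n].
  by rewrite !horner_cfact !big_ord0 subrr mul0r.
by rewrite cfactS_plus cfactS_minus; field.
Qed.

Lemma cmean_cfact n y : cmean (fun y => (cfact n).[y]) y = (cfactX n).[y] :> R.
Proof.
rewrite /cmean; case: n => [|n].
  by rewrite !horner_cfact !big_ord0 hornerE [_ *: _]mulrDr; field.
rewrite cfactS_plus cfactS_minus /= hornerM hornerX [_ *: _]mulrDr; by field.
Qed.

Lemma cdiff_cfactX n :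
  cdiff (fun y => (cfactX n).[y]) = (fun y => n%:R * (cfactX n.-1).[y] : R).
Proof.
apply/funext => y; rewrite /cdiff; case: n => [|n] /=.
  by rewrite !hornerE subrr.
rewrite !hornerM !hornerX; case: n => [|n] /=.
  by rewrite !horner_cfact !big_ord0 (hornerC 1) !mulr1; field.
by rewrite cfactS_plus cfactS_minus hornerM hornerX; field.
Qed.

(** Both bases behave under [cdiff] as monomials do under differentiation. For m > n the falling
    factorial is 0, so the truncated [n - m] is harmless. *)
Lemma iter_cdiff_ffact (f : nat -> {poly R}) :
  (forall n, cdiff (fun y => (f n).[y]) = (fun y => n%:R * (f n.-1).[y] : R)) ->
  forall m n, iter m cdiff (fun y => (f n).[y]) =
    (fun y => (n ^_ m)%:R * (f (n - m)%N).[y] : R).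
Proof.
move=> fE; elim=> [|m IH] n.
  by apply/funext => y; rewrite ffactn0 mul1r subn0.
apply/funext => y; rewrite iterS IH /cdiff -mulrBr.
have := congr1 (@^~ y) (fE (n - m)%N); rewrite /cdiff => ->.
by rewrite mulrA -natrM -ffactnSr subnS.
Qed.

End central_differences.

(** * The remainder functional and its values on monomials *)

Section midpoint_functional.
Context {R : realType}.
Implicit Types (b : bool) (W : lmodType R).

(* Also makes sense for n = 0, 1, where it is -1: the leading terms of the two
   formulae thus become the terms i = 0 of their sums. *)
Definition cdcoef (n : nat) : R := - (cfact n./2.*2).[0] / n`!%:R.

Definition midop {W} b (V : R -> W) : R -> W := if b then cdiff V else cmean V.

(** In the rescaled variable, this is everything in the remainder except the exact value or
    derivative; the term i = 0 is minus the leading difference or mean. *)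
Definition midsum {W} (p : nat) b (V : R -> W) : W :=
  \sum_(i < p.+1) cdcoef (2 * i + b) *: midop b (iter (2 * i) cdiff V) 0.

Lemma iter_cdiffD {W} n (f g : R -> W) :
  iter n cdiff (fun y => f y + g y) =
  (fun y => iter n cdiff f y + iter n cdiff g y).
Proof.
elim: n => [//|n IH]; rewrite !iterS IH; apply/funext => y.
by rewrite /cdiff opprD addrACA.
Qed.

Lemma iter_cdiffZl {W} n (f : R -> R) (w : W) :
  iter n cdiff (fun y => f y *: w) = (fun y => iter n cdiff f y *: w).
Proof.
elim: n => [//|n IH]; rewrite !iterS IH; apply/funext => y.
by rewrite /cdiff scalerBl.
Qed.

Lemma midsumD {W} p b (f g : R -> W) :
  midsum p b (fun y => f y + g y) = midsum p b f + midsum p b g.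
Proof.
rewrite -big_split; apply: eq_bigr => i _ /=; rewrite iter_cdiffD -scalerDr.
congr (_ *: _); case: b; rewrite /midop ?/cdiff ?/cmean.
  by rewrite opprD addrACA.
by rewrite -scalerDr addrACA.
Qed.

(** A Taylor term is a real monomial times a fixed vector; this reduces its image to a real number
    times that vector. *)
Lemma midsumZl {W} p b (f : R -> R) (w : W) :
  midsum p b (fun y => f y *: w) = midsum p b f *: w.
Proof.
rewrite scaler_suml; apply: eq_bigr => i _; rewrite iter_cdiffZl.
transitivity (cdcoef (2 * i + b) *: (midop b (iter (2 * i) cdiff f) 0 *: w)).
  congr (_ *: _); case: b => /=; first by rewrite /cdiff scalerBl.
  by rewrite /cmean -scalerDl scalerA.
by rewrite scalerA.
Qed.

Lemma midsum_sum {W} p b n (F : nat -> R -> W) :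
  midsum p b (fun y => \sum_(j < n) F j y) = \sum_(j < n) midsum p b (F j).
Proof.
elim: n => [|n IH].
  rewrite big_ord0 -[RHS](scaler0 _ (midsum p b (fun=> 0))) -midsumZl.
  by congr midsum; apply/funext => y; rewrite big_ord0 scaler0.
rewrite big_ord_recr /= -IH -midsumD.
by congr midsum; apply/funext => y; rewrite big_ord_recr.
Qed.

(* As b <= 1, f`_b is the b-th derivative of f at 0. *)
Definition midrem (p : nat) b (f : {poly R}) : R :=
  f`_b + midsum p b (fun y => f.[y]).

Lemma midremD p b f g : midrem p b (f + g) = midrem p b f + midrem p b g.
Proof.
rewrite /midrem coefD addrACA -midsumD; congr (_ + midsum p b _).
by apply/funext => y; rewrite hornerD.
Qed.

Lemma midremZ p b a f : midrem p b (a *: f) = a * midrem p b f.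
Proof.
rewrite /midrem coefZ mulrDr; congr (_ + _).
rewrite mulrC -[RHS](midsumZl p b (fun y => f.[y]) (a : R)); congr midsum.
by apply/funext => y; rewrite hornerZ mulrC.
Qed.

(* Any sequence of monic polynomials B j of degree j is a basis. *)
Lemma midrem_eq0 p b (B : nat -> {poly R}) n :
  (forall j, B j \is monic) -> (forall j, size (B j) = j.+1) ->
  (forall j, (j < n)%N -> midrem p b (B j) = 0) ->
  forall f : {poly R}, (size f <= n)%N -> midrem p b f = 0.
Proof.
move=> Bm sB; elim: n => [|n IH] B0 f sf.
  move: sf; rewrite leqn0 size_poly_eq0 => /eqP ->.
  by rewrite -(scale0r 0) midremZ mul0r.
(* Subtracting this multiple of the monic [B n] removes the coefficient of degree n. *)
rewrite -(subrK (f`_n *: B n) f) midremD midremZ B0// mulr0 addr0.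
apply: IH => [j jn|]; first exact/B0/ltnW.
apply/leq_sizeP => j; rewrite leq_eqVlt coefB coefZ => /predU1P[<-|nj].
  have := Bm n; rewrite monicE /lead_coef sB => /eqP /= ->.
  by rewrite mulr1 subrr.
have -> : f`_j = 0 by rewrite nth_default// (leq_trans sf).
by rewrite [(B n)`_j]nth_default ?sB// mulr0 subrr.
Qed.

(** The basis is matched to the outer operator: [cdiff] on [cfactX] and [cmean] on [cfact] both
    produce multiples of some [cfactX], which vanishes at 0 unless its index is 0. *)
Definition midbasis b : nat -> {poly R} := if b then cfactX else cfact.

Lemma midbasis_monic b n : midbasis b n \is monic.
Proof. by case: b; [exact: cfactX_monic | exact: cfact_monic]. Qed.

Lemma size_midbasis b n : size (midbasis b n) = n.+1.
Proof. by case: b; [exact: size_cfactX | exact: size_cfact]. Qed.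

Lemma midop_midbasis b n m :
  midop b (iter m cdiff (fun y => (midbasis b n).[y])) 0 =
  (m + b == n)%N%:R * n`!%:R.
Proof.
(* For j > n the falling factorial vanishes; for j < n the polynomial has the factor x; for j = n
   what remains is n!. *)
have E j : (n ^_ j)%:R * (cfactX (n - j)).[0] = (j == n)%:R * n`!%:R :> R.
  case: (ltngtP j n) => jn /=; last 2 first.
  - by rewrite ffact_small// !mul0r.
  - by rewrite jn subnn ffactnn hornerC mulr1 mul1r.
  by case: (n - j)%N (subn_gt0 j n) => [|d];
    rewrite jn//= hornerM hornerX !mul0r mulr0.
case: b => /=.
  rewrite -[cdiff _]/(iter m.+1 cdiff _) (iter_cdiff_ffact cfactX).
    by rewrite E addn1.
  exact: cdiff_cfactX.
rewrite (iter_cdiff_ffact cfact); last exact: cdiff_cfact.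
rewrite addn0 -E -cmean_cfact /cmean -mulrDr.
exact: mulrCA.
Qed.

(** The coefficient is q_n(0) for b = 0 and, if n > 0, q_(n-1)(0) for b = 1. It vanishes when n does
    not have the parity of b, and otherwise the index is [n./2.*2] in both cases. *)
Lemma midbasis_coef b n :
  (midbasis b n)`_b = - ((odd n == b)%:R * (cdcoef n * n`!%:R)).
Proof.
have -> : cdcoef n * n`!%:R = - (cfact n./2.*2).[0].
  by rewrite /cdcoef divfK// pnatr_eq0 -lt0n fact_gt0.
rewrite mulrN opprK.
have E m : (cfact m)`_0 = (~~ odd m)%:R * (cfact m./2.*2).[0] :> R.
  rewrite -horner_coef0; case: (boolP (odd m)) => om /=.
    by rewrite cfact_odd_0// mul0r.
  by rewrite mul1r even_halfK.
case: b => /=; last by rewrite E eqbF_neg.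
case: n => [|n]; first by rewrite coefC mul0r.
rewrite /= coefXM/= E eqb_id; case: (boolP (odd n)) => on.
  by rewrite !mul0r.
by rewrite uphalf_half (negbTE on).
Qed.

(** If n = 2l + b with l <= p, only the term i = l sees the basis element and it cancels the
    coefficient. If l = p + 1, that term is missing from the sum and the coefficient survives. For
    the other parity everything is 0. *)
Lemma midrem_midbasis p b n : (n <= 2 * p + 2 + b)%N ->
  midrem p b (midbasis b n) =
  - ((n == 2 * p + 2 + b)%N%:R * (cdcoef n * n`!%:R)).
Proof.
move=> nle; rewrite /midrem midbasis_coef /midsum.
under eq_bigr do rewrite midop_midbasis.
case: (boolP (odd n == b)) => [/eqP ob|ob].
  have nE : (n = 2 * n./2 + b)%N by rewrite -ob addnC mul2n odd_double_half.
  case: (boolP (n == _)) => [/eqP nE'|nN].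
    rewrite big1 ?addr0// => i _.
    rewrite (_ : (_ == n) = false) ?mul0r ?scaler0//.
    by apply/negbTE/eqP; have := ltn_ord i; lia.
  have ltp : (n./2 < p.+1)%N by move: nN nle => /eqP; lia.
  rewrite (bigD1 (Ordinal ltp))//= -nE eqxx big1 ?addr0.
    by rewrite !mul1r mul0r [_ *: _]mulrC mulrC addNr oppr0.
  move=> i iN; rewrite (_ : (_ == n) = false) ?mul0r ?scaler0//.
  apply/negbTE; apply: contra iN => /eqP iE; apply/eqP/val_inj => /=; lia.
rewrite big1 ?addr0 => [|i _].
  rewrite (_ : (n == _) = false) ?mul0r// .
  by apply/negbTE; apply: contra ob => /eqP ->; rewrite -mulnSr oddD oddM oddb.
rewrite (_ : (_ == n) = false) ?mul0r ?scaler0//.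
by apply/negbTE; apply: contra ob => /eqP <-; rewrite oddD oddM oddb.
Qed.

(** The monomial and the monic basis element of the same degree differ by a polynomial of lower
    degree, on which the functional vanishes. *)
Lemma midrem_Xn p b n : (n <= 2 * p + 2 + b)%N ->
  midrem p b 'X^n = - ((n == 2 * p + 2 + b)%N%:R * (cdcoef n * n`!%:R)).
Proof.
move=> nle; rewrite -midrem_midbasis// -(subrK (midbasis b n) 'X^n) midremD.
rewrite (@midrem_eq0 p b (midbasis b) n) ?add0r//.
- exact: midbasis_monic.
- exact: size_midbasis.
- move=> j jn; rewrite midrem_midbasis; last by rewrite ltnW// (leq_trans jn).
  by rewrite (_ : (_ == _) = false) ?mul0r ?oppr0//; apply/negbTE/eqP; lia.
apply/leq_sizeP => j; rewrite leq_eqVlt coefB coefXn => /predU1P[<-|nj].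
  have := midbasis_monic b n.
  rewrite monicE /lead_coef size_midbasis => /eqP /= ->.
  by rewrite eqxx subrr.
by rewrite gtn_eqF// nth_default ?size_midbasis// subrr.
Qed.

End midpoint_functional.

(** * Derivatives along a set, mean value inequality, uniform Taylor formula *)

Section taylor.
Context {R : realType} {X : normedModType R}.
Set Implicit Arguments.
Unset Strict Implicit.
Implicit Types (A : set R) (f g : R -> X) (l : X).

(** First-order expansion without division: it covers x = c and, through [A], one-sided derivatives
    at endpoints. *)
Definition has_deriv A f c l := forall e : R, 0 < e ->
  exists2 d, 0 < d & forall x, A x -> `|x - c| < d ->
    `|f x - f c - (x - c) *: l| <= e * `|x - c|.

Lemma has_derivD A f g c l m : has_deriv A f c l -> has_deriv A g c m ->
  has_deriv A (fun x => f x + g x) c (l + m).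
Proof.
move=> fl gm e e0; have e20 : 0 < e / 2 by lra.
have [d d0 fd] := fl _ e20; have [d' d'0 gd] := gm _ e20.
exists (Num.min d d') => [|x Ax]; first by rewrite lt_min d0.
rewrite lt_min => /andP[xd xd'].
rewrite [leRHS](_ : _ = e / 2 * `|x - c| + e / 2 * `|x - c|); last by field.
apply: le_trans (lerD (fd _ Ax xd) (gd _ Ax xd')).
apply: le_trans (ler_normD _ _); rewrite le_eqVlt; apply/orP; left; apply/eqP.
congr `|_|; rewrite scalerDr !opprD.
by rewrite [RHS]addrACA -!addrA; congr (_ + _); rewrite [RHS]addrCA.
Qed.

Lemma has_derivN A f c l :
  has_deriv A f c l -> has_deriv A (fun x => - f x) c (- l).
Proof.
move=> fl e /fl[d d0 fd]; exists d => // x Ax /(fd _ Ax).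
by rewrite -normrN scalerN !opprD !opprK.
Qed.

Lemma has_deriv_cst A c w : has_deriv A (fun=> w) c 0.
Proof.
move=> e e0; exists 1 => // x _ _.
by rewrite scaler0 subrr subr0 normr0 mulr_ge0// ltW.
Qed.

Lemma has_deriv_sum A n (F : nat -> R -> X) c (l : nat -> X) :
  (forall j, has_deriv A (F j) c (l j)) ->
  has_deriv A (fun x => \sum_(j < n) F j x) c (\sum_(j < n) l j).
Proof.
move=> Fl; elim: n => [|n IH].
  rewrite big_ord0 [F in has_deriv _ F](_ : _ = fun=> 0).
    exact: has_deriv_cst.
  by apply/funext => x; rewrite big_ord0.
rewrite big_ord_recr [F in has_deriv _ F](_ : _ =
  fun x => \sum_(j < n) F j x + F n x); first exact: has_derivD.
by apply/funext => x; rewrite big_ord_recr.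
Qed.

Lemma derivable_on_has_deriv A f c :
  derivable_on A f c -> has_deriv A f c (derive_on A f c).
Proof.
move=> fd e e0.
have F0 : Filter (within [set h | A (h + c)] (0 : R)^') by exact: within_filter.
have /(cvgrPdist_lt _ _).1 /(_ e e0) := fd.
rewrite near_withinE => /nbhs_ballP[d d0 dP].
exists d => // x Ax xd; have [->|xc] := eqVneq x c.
  by rewrite !subrr scale0r subr0 !normr0 mulr0.
have x0 : x - c != 0 by rewrite subr_eq0.
have := dP (x - c); rewrite /ball/= sub0r normrN => /(_ xd x0).
rewrite subrK distrC => /(_ Ax) /ltW lee.
rewrite (_ : _ - _ = (x - c) *: ((x - c)^-1 *: (f x - f c) - derive_on A f c));
  last first.
  by rewrite scalerBr scalerA divff// scale1r.
by rewrite normrZ mulrC ler_wpM2r.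
Qed.

Lemma has_deriv_horner A (p : {poly R}) c (w : X) :
  has_deriv A (fun x => p.[x] *: w) c (p^`().[c] *: w).
Proof.
move=> e e0; have e10 : 0 < e / (`|w| + 1) by rewrite divr_gt0// ltr_wpDl.
have [dp dpE] := is_derive_poly p c.
have /(cvgrPdist_lt _ _).1 /(_ _ e10) := dp.
rewrite near_withinE => /nbhs_ballP[d d0 dP].
exists d => // x Ax xd; have [->|xc] := eqVneq x c.
  by rewrite !subrr scale0r subr0 !normr0 mulr0.
have x0 : x - c != 0 by rewrite subr_eq0.
have := dP (x - c); rewrite /ball/= sub0r normrN => /(_ xd x0).
rewrite [X in `|X - _|]dpE [X in X + c](mulr1 _) subrK distrC => /ltW lee.
rewrite -scalerBl scalerA -scalerBl normrZ.
rewrite (_ : _ - _ = (x - c) * ((x - c)^-1 *: (p.[x] - p.[c]) - p^`().[c])).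
  rewrite normrM -mulrA mulrC.
  apply: ler_wpM2r => //; apply: le_trans (ler_wpM2r (normr_ge0 w) lee) _.
  rewrite -mulrA ler_piMr ?(ltW e0)// mulrC ler_pdivrMr ?ltr_wpDl// mul1r.
  by rewrite lerDl.
by rewrite mulrBr [_ *: _]/(_ * _) mulrA divff// mul1r.
Qed.

(* The supremum c of the x for which the bound holds between a and x is
   attained, and the local bound at c would go past c if c < b. *)
Lemma local_lipschitz_segment f (a b M : R) : a <= b ->
  (forall c, a <= c <= b -> exists2 d, 0 < d &
    forall x, a <= x <= b -> `|x - c| < d -> `|f x - f c| <= M * `|x - c|) ->
  `|f b - f a| <= M * (b - a).
Proof.
move=> ab lip.
pose S := [set x | a <= x <= b /\ `|f x - f a| <= M * (x - a)].
have Sa : S a by split; [rewrite lexx | rewrite !subrr normr0 mulr0].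
have Sub : ubound S b by move=> x [/andP[]].
have Ssup : has_sup S by split; [exists a | exists b].
set c := sup S.
have ac : a <= c by exact: (ub_le_sup Ssup.2).
have cb : c <= b by apply: ge_sup => //; exists a.
have [|d d0 cd] := lip c; first by rewrite ac.
have Sc : S c.
  split; first by rewrite ac.
  have [x [/andP[ax xb] Sx] xc] := sup_adherent d0 Ssup.
  have xlec : x <= c by apply: (ub_le_sup Ssup.2); split; rewrite ?ax.
  have := cd x; rewrite ax xb ler0_norm ?subr_le0// opprB => /(_ isT).
  rewrite ltrBlDr addrC -ltrBlDr => /(_ xc); rewrite distrC => fcx.
  rewrite -(subrK (f x) (f c)) -addrA (le_trans (ler_normD _ _))//.
  by rewrite (le_trans (lerD fcx Sx))// -mulrDr addrA subrK.
have [bc|cltb] := leP b c.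
  by rewrite (_ : b = c) ?Sc.2//; apply/le_anti/andP.
pose x := Num.min b (c + d / 2).
have cx : c < x by rewrite lt_min cltb ltrDl divr_gt0.
have xb : x <= b by rewrite ge_min lexx.
have xd : x <= c + d / 2 by rewrite ge_min lexx orbT.
have ax : a <= x by rewrite (le_trans ac)// ltW.
have := cd x; rewrite ax xb gtr0_norm ?subr_gt0// => /(_ isT) fx.
have {}fx : `|f x - f c| <= M * (x - c) by apply: fx; lra.
suff Sx : S x by have := ub_le_sup Ssup.2 Sx; rewrite leNgt cx.
split; first by rewrite ax.
rewrite -(subrK (f c) (f x)) -addrA (le_trans (ler_normD _ _))//.
by rewrite (le_trans (lerD fx Sc.2))// -mulrDr addrA subrK.
Qed.

Lemma has_deriv_bound A f c l M : has_deriv A f c l -> `|l| < M ->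
  exists2 d, 0 < d & forall x, A x -> `|x - c| < d ->
    `|f x - f c| <= M * `|x - c|.
Proof.
move=> fl lM; have [|d d0 fd] := fl (M - `|l|); first by rewrite subr_gt0.
exists d => // x Ax xd; rewrite -(subrK ((x - c) *: l) (f x - f c)).
rewrite (le_trans (ler_normD _ _))// (le_trans (lerD (fd _ Ax xd) (lexx _)))//.
by rewrite normrZ mulrBl [_ * `|l|]mulrC subrK.
Qed.

(** The strict bound on the derivative leaves the room M - |l c| for the local error, so f is
    locally M-Lipschitz at each point. *)
Lemma mean_value_le A f (l : R -> X) a b M : a <= b ->
  (forall c, a <= c <= b -> A c) ->
  (forall c, a <= c <= b -> has_deriv A f c (l c) /\ `|l c| < M) ->
  `|f b - f a| <= M * (b - a).
Proof.
move=> ab abA fl; apply: local_lipschitz_segment => // c /fl[fc lM].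
have [d d0 fd] := has_deriv_bound fc lM.
by exists d => // x /abA; exact: fd.
Qed.

(** Below the top order, continuity follows from differentiability: near [a] the m-th derivative is
    Lipschitz with constant |l| + 1. *)
Lemma continuously_derivable_le m n T f : (m <= n)%N ->
  continuously_derivable n T f -> continuously_derivable m T f.
Proof.
rewrite leq_eqVlt => /predU1P[->//|mn] [fd fc]; split.
  by move=> j a jm; apply: fd; exact: ltn_trans mn.
apply/subspace_continuousP => a aT.
have := fd m a mn aT => /derivable_on_has_deriv/has_deriv_bound.
set l := derive_on _ _ _ => /(_ (`|l| + 1)).
rewrite ltrDl => /(_ ltr01)[d d0 H].
apply/cvgrPdist_lt => e e0; rewrite near_withinE.
have M0 : 0 < `|l| + 1 by rewrite ltr_wpDl.
apply/nbhs_ballP; exists (Num.min d (e / (`|l| + 1))) => /=.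
  by rewrite lt_min d0 divr_gt0.
move=> x; rewrite /ball/= lt_min distrC => /andP[xd xe] xT.
rewrite distrC (le_lt_trans (H x xT xd))//.
by rewrite mulrC -ltr_pdivlMr.
Qed.

Lemma segment_unif_continuous T f : {within `[0, T], continuous f} ->
  forall e, 0 < e -> exists2 d, 0 < d & forall s x, s \in `[0, T] ->
    x \in `[0, T] -> `|x - s| < d -> `|f x - f s| <= e.
Proof.
move=> /subspace_continuousP fc e e0.
(* Membership of [s] is part of [P] because the covering neighbourhoods may leave the segment. *)
pose P (d s : R) := forall x, x \in `[0, T] -> `|x - s| < d ->
  s \in `[0, T] -> `|f x - f s| <= e.
have H : \forall d \near 0^'+, `[0, T] `<=` P d.
  apply: ((compact_near_coveringP _).1 (@segment_compact R 0 T)) => s sT.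
   have e20 : 0 < e / 2 by rewrite divr_gt0.
  have /(cvgrPdist_lt _ _).1 /(_ _ e20) := fc s sT.
  rewrite near_withinE => /nbhs_ballP[d d0 dP].
  have d20 : 0 < d / 2 by rewrite divr_gt0.
  exists (ball s (d / 2), [set t | t < d / 2]) => /=.
    by split; [exact: nbhsx_ballx | exact: nbhs_right_lt].
  move=> [y t] /= [ys td] x xT xy yT.
  have fy : `|f s - f y| < e / 2.
    by apply: dP => //; apply: le_ball ys; lra.
  have fx : `|f s - f x| < e / 2.
    apply: dP => //; rewrite /ball/= -(subrK y s) -addrA.
    rewrite (le_lt_trans (ler_normD _ _))// [`|y - x|]distrC.
    by move: ys xy td; rewrite /ball/=; lra.
  rewrite -(subrK (f s) (f x)) -addrA (le_trans (ler_normD _ _))//.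
  by rewrite [`|f x - _|]distrC; lra.
have [d [dP d0]] : exists d : R, `[0, T] `<=` P d /\ 0 < d.
  apply: (@filter_ex _ (nbhs (0 : R)^'+)); apply: filterI; first exact: H.
  exact: nbhs_right_gt.
by exists d => // s x sT xT xs; exact: dP.
Qed.

Lemma segment_bounded T f : {within `[0, T], continuous f} ->
  exists M, forall s, s \in `[0, T] -> `|f s| <= M.
Proof.
move=> fc; have := continuous_compact fc (@segment_compact R 0 T).
move=> /compact_bounded.
move=> /pinfty_ex_gt0[M _ HM]; exists M => s sT; apply: HM.
by exists s.
Qed.

(** Induction on m: the remainder [G] of f vanishes at s, and its derivative is the remainder [G']
    of f', to which the induction hypothesis and then the mean value inequality apply. The base case
    is uniform continuity, so d does not depend on s. *)
Lemma taylor_segment m T f : continuously_derivable m T f ->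
  forall e, 0 < e -> exists2 d, 0 < d & forall s x, s \in `[0, T] ->
    x \in `[0, T] -> `|x - s| < d ->
    `|f x - \sum_(j < m.+1) ((x - s) ^+ j / j`!%:R) *:
        derive_onn j `[0, T] f s| <= e * `|x - s| ^+ m.
Proof.
elim: m f => [|m IH] f [fd fc] e e0.
  have [d d0 dP] := segment_unif_continuous fc e0; exists d => // s x sT xT xs.
  by rewrite big_ord1 expr0 divr1 scale1r mulr1; exact: dP.
(* Half of e makes the bound on [G'] strict when x differs from s, as [mean_value_le] requires. *)
have e20 : 0 < e / 2 by rewrite divr_gt0.
have f'C : continuously_derivable m T (derive_on `[0, T] f).
  by split=> [j a jm aT|]; rewrite /derive_onn -iterSr; [exact: fd | exact: fc].
have [d d0 dP] := IH _ f'C _ e20.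
exists d => // s x sT xT xs.
pose G y := f y - \sum_(j < m.+2) ((y - s) ^+ j / j`!%:R) *:
        derive_onn j `[0, T] f s.
pose G' y := derive_on `[0, T] f y - \sum_(j < m.+1) ((y - s) ^+ j / j`!%:R) *:
        derive_onn j `[0, T] (derive_on `[0, T] f) s.
have Gs : G s = 0.
  rewrite /G big_ord_recl /= expr0 divr1 scale1r big1 ?addr0 ?subrr// => i _.
  by rewrite expr0n mul0r scale0r.
have GG' y : y \in `[0, T] -> has_deriv `[0, T] G y (G' y).
  move=> yT; apply: has_derivD; first exact/derivable_on_has_deriv/(fd 0%N).
  apply: has_derivN.
  pose p j := j`!%:R^-1 *: ('X - s%:P) ^+ j.
  have pE j z : (p j).[z] = (z - s) ^+ j / j`!%:R.
    by rewrite hornerZ horner_exp hornerXsubC mulrC.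
  have p'E j : (p j.+1)^`().[y] = (y - s) ^+ j / j`!%:R.
    rewrite /p derivZ deriv_exp derivXsubC mul1r hornerZ hornerMn horner_exp.
    rewrite hornerXsubC factS natrM; field.
    by rewrite nat1r !pnatr_eq0 -lt0n fact_gt0.
  rewrite (_ : \sum_(j < _) _ = \sum_(j < m.+2) (p j)^`().[y] *:
    derive_onn j `[0, T] f s); last first.
    rewrite [RHS]big_ord_recl /p expr0 derivZ derivC scaler0 horner0 scale0r.
    rewrite add0r; apply: eq_bigr => j _; rewrite lift0 p'E.
    by rewrite /derive_onn -iterSr.
  rewrite (_ : (fun z => \sum_(j < m.+2) _) = (fun z => \sum_(j < m.+2)
    (p j).[z] *: derive_onn j `[0, T] f s)); last first.
    by apply/funext => z; apply: eq_bigr => j _; rewrite pE.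
  apply: (@has_deriv_sum _ _ 
    (fun j z => (p j).[z] *: derive_onn j `[0, T] f s) _
    (fun j => (p j)^`().[y] *: derive_onn j `[0, T] f s) _).
  by move=> j; exact: has_deriv_horner.
have [->|xNs] := eqVneq x s.
  by rewrite -/(G s) Gs normr0 mulr_ge0// ?ltW// exprn_ge0.
have xs0 : 0 < `|x - s| by rewrite normr_gt0 subr_eq0.
have bd c : c \in `[0, T] -> `|c - s| <= `|x - s| ->
    has_deriv `[0, T] G c (G' c) /\ `|G' c| < e * `|x - s| ^+ m.
  move=> cT cs; split; first exact: GG'.
  rewrite (le_lt_trans (dP s c sT cT _))//; first exact: le_lt_trans xs.
  rewrite (@le_lt_trans _ _ (e / 2 * `|x - s| ^+ m))//.
    by rewrite ler_pM2l ?divr_gt0// lerXn2r// nnegrE.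
  by rewrite ltr_pM2r ?exprn_gt0//; lra.
rewrite -/(G x) exprSr mulrA.
have [sx|xltS] := leP s x.
  have -> : G x = G x - G s by rewrite Gs subr0.
  rewrite [X in _ * X]ger0_norm ?subr_ge0//.
  have sub c : s <= c <= x -> c \in `[0, T].
    move=> /andP[sc cx]; move: sT xT.
    rewrite !in_itv/= => /andP[? ?] /andP[? ?]; by apply/andP; split; lra.
  apply: (@mean_value_le `[0, T] _ G') => // c cI; apply: bd; first exact: sub.
  by move: cI => /andP[sc cx]; rewrite !ger0_norm ?subr_ge0//; lra.
rewrite -normrN.
have -> : - G x = G s - G x by rewrite Gs sub0r.
rewrite [X in _ * X]distrC [X in _ * X]ger0_norm ?subr_ge0 ?(ltW xltS)//.
have sub c : x <= c <= s -> c \in `[0, T].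
  move=> /andP[sc cx]; move: sT xT; rewrite !in_itv/= => /andP[? ?] /andP[? ?].
  by apply/andP; split; lra.
apply: (@mean_value_le `[0, T] _ G') => // [|c cI]; first exact: ltW.
apply: bd; first exact: sub.
by move: cI => /andP[sc cx]; rewrite [leLHS]distrC [leRHS]distrC
  !ger0_norm ?subr_ge0//; lra.
Qed.

End taylor.

(** * From the functional to the remainders of the two formulae *)

Section remainders.
Context {R : realType} {X : normedModType R}.
Set Implicit Arguments.
Unset Strict Implicit.
Implicit Types (k s T : R) (v f : R -> X) (b : bool).

(** In the variable y a step k is a unit step, and a forward after a backward difference is the
    second central difference. *)
Lemma DpDm_iter_cdiff k v s i y : k != 0 ->
  k ^+ (2 * i) *: DpDm i k v (s + k * y) =
  iter (2 * i) cdiff (fun z => v (s + k * z)) y.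
Proof.
move=> k0; elim: i y => [|i IH] y; first by rewrite expr0 scale1r.
rewrite mulnSr addn2 !iterS /cdiff -!IH /DpDm iterS -/(DpDm i k v).
rewrite /Dplus /Dminus -scalerBr !scalerA.
rewrite (_ : k ^+ _ * _ * _ = k ^+ (2 * i)); last by rewrite !exprSr !mulfK.
rewrite -!scalerBr.
have -> : s + k * y + k - k = s + k * (y + 2^-1 - 2^-1) by field.
have -> : s + k * y + k = s + k * (y + 2^-1 + 2^-1) by field.
have -> : s + k * y - k = s + k * (y - 2^-1 - 2^-1) by field.
by rewrite subrK addrK.
Qed.

Definition midpoint_rem b (c : nat -> R) :
    nat -> R -> (R -> X) -> R -> nat -> X :=
  if b then rem_derivative c else rem_value c.

Lemma cdcoef_bool b : cdcoef b = -1 :> R.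
Proof.
by rewrite /cdcoef; case: b; rewrite /= horner_cfact big_ord0 divr1.
Qed.

Lemma midpoint_rem_midsum b p T v k n : k != 0 ->
  k ^+ b *: midpoint_rem b cdcoef p T v k n =
  k ^+ b *: derive_onn b `[0, T] v (t_half k n) +
  midsum p b (fun y => v (t_half k n + k * y)).
Proof.
move=> k0; rewrite /midsum big_ord_recl.
under eq_bigr do rewrite lift0.
(* The term i = 0, with coefficient -1, is the leading term of the formula. *)
rewrite [X in _ + (X + _)](_ : _ =
  - midop b (fun y => v (t_half k n + k * y)) 0);
  last by rewrite /= muln0 add0n cdcoef_bool scaleN1r.
have tS : t_ k n.+1 = t_half k n + k * (0 + 2^-1) by rewrite /t_ /t_half; field.
have tn : t_ k n = t_half k n + k * (0 - 2^-1) by rewrite /t_ /t_half; field.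
have DE i : k *: Dmid k (DpDm i k v) (t_half k n) =
  DpDm i k v (t_half k n + k * (0 + 2^-1)) -
  DpDm i k v (t_half k n + k * (0 - 2^-1)).
  rewrite /Dmid scalerA divff// scale1r.
  by rewrite !add0r mulrN.
have EE i : Emid k (DpDm i k v) (t_half k n) = 2^-1 *:
  (DpDm i k v (t_half k n + k * (0 + 2^-1)) +
   DpDm i k v (t_half k n + k * (0 - 2^-1))).
  by rewrite /Emid !add0r mulrN.
have cdE (f : R -> X) y : cdiff f y = f (y + 2^-1) - f (y - 2^-1) by [].
have cmE (f : R -> X) y :
  cmean f y = 2^-1 *: (f (y + 2^-1) + f (y - 2^-1)) by [].
rewrite /midpoint_rem; case: b; rewrite ?expr1 ?expr0.
  rewrite /rem_derivative /midop cdE -tS -tn scalerBr (scalerBr _ (k^-1 *: _)).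
  rewrite scalerA divff// scale1r opprB; congr (_ + _).
  rewrite addrC; congr (_ + _).
  rewrite big_add1 big_mkord scaler_sumr; apply: eq_bigr => i _.
  rewrite -[nat_of_bool true]/1%N; move: (cdcoef _) => C.
  rewrite scalerA mulrC -!scalerA DE cdE -!DpDm_iter_cdiff//.
  by rewrite scalerBr.
rewrite /rem_value /midop cmE !scale1r -tS -tn opprB; congr (_ + _).
rewrite addrC; congr (_ + _).
rewrite big_add1 big_mkord; apply: eq_bigr => i _.
rewrite addn0; move: (cdcoef _) => C.
rewrite -scalerA EE cmE -!DpDm_iter_cdiff//.
do 2 move: (DpDm _ _ _ _) => ?.
by rewrite -scalerDr [k ^+ _ *: _]scalerA [k ^+ _ * _]mulrC -scalerA.
Qed.

Lemma iter_cdiff_bound f (B M : R) : (forall y, `|y| <= B -> `|f y| <= M) ->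
  forall m y, `|y| + m%:R / 2 <= B -> `|iter m cdiff f y| <= 2 ^+ m * M.
Proof.
move=> fM; elim=> [|m IH] y; first by rewrite mul0r addr0 mul1r => /fM.
rewrite -natr1 => yB; rewrite iterS /cdiff (le_trans (ler_normB _ _))//.
rewrite exprS -mulrA mulr_natl mulr2n lerD// IH//.
  by have := ler_normD y 2^-1; rewrite [`|2^-1|]ger0_norm//; lra.
by have := ler_normB y 2^-1; rewrite [`|2^-1|]ger0_norm//; lra.
Qed.

(** At most 2p differences and the outer operator, each moving by 1/2, stay within p + 1/2 of 0. *)
Lemma midsum_bound p b : exists2 K, 0 < K & forall f M,
  (forall y, `|y| <= p%:R + 2^-1 -> `|f y| <= M) -> `|midsum p b f| <= K * M.
Proof.
(* The power of 2 bounds the iterated difference, the factor 2 the outer operator; the added 1 gives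
   positivity at once. *)
exists (\sum_(i < p.+1) `|cdcoef (2 * i + b)| * (2 * 2 ^+ (2 * i)) + 1).
  by rewrite ltr_wpDl// sumr_ge0.
move=> f M fM.
have M0 : 0 <= M.
  by apply: le_trans (fM 0 _); rewrite ?normr_ge0// normr0 addr_ge0.
rewrite mulrDl mul1r (le_trans (ler_norm_sum _ _ _))//.
rewrite ler_wpDr// mulr_suml ler_sum// => i _.
rewrite normrZ -!mulrA ler_wpM2l//.
have ip : (i%:R : R) <= p%:R by rewrite ler_nat -ltnS.
have h0 : `|2^-1 : R| = 2^-1 by rewrite ger0_norm.
have b1 : `|iter (2 * i) cdiff f (0 + 2^-1)| <= 2 ^+ (2 * i) * M.
  by apply: iter_cdiff_bound fM _ _ _; rewrite add0r h0 natrM; lra.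
have b2 : `|iter (2 * i) cdiff f (0 - 2^-1)| <= 2 ^+ (2 * i) * M.
  by apply: iter_cdiff_bound fM _ _ _; rewrite add0r normrN h0 natrM; lra.
have Q0 : 0 <= 2 ^+ (2 * i) * M by rewrite mulr_ge0// exprn_ge0.
case: b => /=.
  by rewrite /cdiff (le_trans (ler_normB _ _))//; lra.
rewrite /cmean normrZ h0.
have := ler_normD (iter (2 * i) cdiff f (0 + 2^-1))
  (iter (2 * i) cdiff f (0 - 2^-1)).
lra.
Qed.

(** The Taylor polynomial of degree r contributes exactly the leading error term, and the functional
    applied to the Taylor remainder [rho] is small compared with k^r. *)
Lemma midpoint_rem_littleo b p T v :
  continuously_derivable (2 * p + 3) T v ->
  grid_littleo p T (2 * p + 2) (fun k n =>
    midpoint_rem b cdcoef p T v k n -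
    ((-1) ^+ true * cdcoef (2 * p + 2 + b) * k ^+ (2 * p + 2)) *:
      derive_onn (2 * p + 2 + b) `[0, T] v (t_half k n)).
Proof.
set r := (2 * p + 2 + b)%N => vC e e0.
have br : (b < r)%N by rewrite /r; case: (b) => /=; lia.
have [K K0 KP] := midsum_bound p b.
have vr : continuously_derivable r T v.
  by apply: continuously_derivable_le vC; rewrite /r; case: (b) => /=; lia.
have p0 : 0 < p%:R + 1 :> R by rewrite ltr_wpDl.
(* Chosen so that K e' (k (p+1))^r = e k^r. *)
pose e' := e / (K * (p%:R + 1) ^+ r).
have e'0 : 0 < e' by rewrite divr_gt0// mulr_gt0// exprn_gt0.
have [d d0 dP] := taylor_segment vr e'0.
have dp0 : 0 < d / (p%:R + 1) by rewrite divr_gt0.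
have k_gt0 := @nbhs_right_gt R 0.
have k_lt := @nbhs_right_lt R _ _ dp0.
apply: filterS2 k_gt0 k_lt => k k0 kd N n NT pn nN.
rewrite expr1 mulN1r.
set s := t_half k n.
set w := fun j => derive_onn j `[0, T] v s.
pose rho y := v (s + k * y) -
  \sum_(j < r.+1) ('X^j : {poly R}).[y] *: ((k ^+ j / j`!%:R) *: w j).
(* These points lie between t_(n-p) and t_(n+p+1), hence in [0, T] by the bounds on n. *)
have inT y : `|y| <= p%:R + 2^-1 -> s + k * y \in `[0, T].
  rewrite ler_norml => /andP[yl yu]; rewrite in_itv/= -NT /s /t_half /t_.
  have pn' : (p%:R : R) <= n%:R by rewrite ler_nat.
  have nN' : (n%:R + p%:R + 1 : R) <= N%:R.
    by rewrite -natrD natr1 ler_nat -addn1.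
  rewrite [k * y]mulrC -mulrDl; apply/andP; split.
    by rewrite mulr_ge0 ?(ltW k0)//; lra.
  by rewrite ler_pM2r//; lra.
have sT : s \in `[0, T].
  by have := inT 0; rewrite mulr0 addr0 normr0; apply; rewrite addr_ge0.
have rhoM y : `|y| <= p%:R + 2^-1 -> `|rho y| <= e' * (k * (p%:R + 1)) ^+ r.
  move=> yp; have yp1 : `|y| <= p%:R + 1 by lra.
  have ky : `|k * y| <= k * (p%:R + 1) by rewrite normrM gtr0_norm// ler_pM2l.
  have := dP s (s + k * y) sT (inT y yp); rewrite addrAC subrr add0r.
  rewrite (_ : v _ - _ = rho y); last first.
    congr (_ - _); apply: eq_bigr => j _; rewrite hornerXn scalerA.
    by rewrite exprMn mulrA [y ^+ j * _]mulrC.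
  move=> H; apply: le_trans (H _) _.
    by rewrite (le_lt_trans ky)// -ltr_pdivlMr.
  by rewrite ler_pM2l// lerXn2r// nnegrE mulr_ge0 ?ltW.
have kb0 : 0 < k ^+ b by rewrite exprn_gt0.
have key : k ^+ b *: (midpoint_rem b cdcoef p T v k n -
    (- cdcoef r * k ^+ (2 * p + 2)) *: w r) = midsum p b rho.
  rewrite scalerBr midpoint_rem_midsum ?lt0r_neq0//.
  rewrite (_ : (fun y => v _) = (fun y =>
    \sum_(j < r.+1) ('X^j : {poly R}).[y] *:
    ((k ^+ j / j`!%:R) *: w j) + rho y)); last first.
    by apply/funext => y; rewrite [RHS]addrC subrK.
  rewrite midsumD (midsum_sum _ _ _ (fun j y =>
    ('X^j : {poly R}).[y] *: ((k ^+ j / j`!%:R) *: w j))).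
  set Sg := \sum_(j < _) _; set A := k ^+ b *: _; set B := k ^+ b *: _.
  suff -> : Sg = B - A by rewrite addrA addrCA subrr addr0 addrAC subrr add0r.
  rewrite /Sg.
  (* Degree b cancels the exact value or derivative, degree r yields the error term, and all other
     degrees give 0. *)
  have mE j : (j <= r)%N -> midsum p b (fun y => ('X^j : {poly R}).[y]) =
    - ((j == r)%:R * (cdcoef j * j`!%:R)) - (j == b)%:R.
    move=> jr; have := @midrem_Xn R p b j jr.
    rewrite /midrem coefXn eq_sym => <-.
    by rewrite addrAC subrr add0r.
  rewrite (eq_bigr (fun j : 'I_r.+1 =>
    - ((j == r :> nat)%:R * (cdcoef j * j`!%:R)) *: ((k ^+ j / j`!%:R) *: w j) -
    (j == b :> nat)%:R *: ((k ^+ j / j`!%:R) *: w j))); last first.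
    move=> j _; have jr : (j <= r)%N by rewrite -ltnS ltn_ord.
    by rewrite midsumZl mE// scalerBl.
  rewrite sumrB [X in X - _]big_ord_recr /= big1 => [|j _]; last first.
    by rewrite ltn_eqF// mul0r oppr0 scale0r.
  rewrite eqxx mul1r add0r.
  rewrite (bigD1 (Ordinal (ltnW br : (b < r.+1)%N)))//= eqxx.
  rewrite big1 => [|j jb]; last first.
    rewrite (_ : (_ == _) = false) ?scale0r//; apply/negbTE; apply: contra jb.
    by move=> /eqP jb; apply/eqP/val_inj.
  rewrite addr0 scale1r (_ : b`! = 1)%N; last by case: (b).
  rewrite divr1 scalerA.
  rewrite (_ : - (cdcoef r * r`!%:R) * (k ^+ r / r`!%:R) =
    k ^+ b * (- cdcoef r * k ^+ (2 * p + 2))); last first.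
    rewrite /r exprD; field.
    by rewrite pnatr_eq0 -lt0n fact_gt0.
  by rewrite -scalerA.
rewrite -(ler_pM2l kb0).
rewrite -[X in X * `|_|](gtr0_norm kb0) -normrZ key.
apply: le_trans (KP _ _ rhoM) _.
have kr : k ^+ r = k ^+ (2 * p + 2) * k ^+ b by rewrite -exprD.
rewrite exprMn kr /e' le_eqVlt; apply/orP; left; apply/eqP; field.
by rewrite !lt0r_neq0// exprn_gt0.
Qed.

(** The expansion with eps = 1 suffices, since the derivative in its leading term is bounded on
    [0, T]. *)
Lemma midpoint_rem_bigO b p T v :
  continuously_derivable (2 * p + 3) T v ->
  grid_bigO p T (2 * p + 2) (midpoint_rem b cdcoef p T v).
Proof.
move=> vC; have vr : continuously_derivable (2 * p + 2 + b) T v.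
  by apply: continuously_derivable_le vC; case: (b) => /=; lia.
have [M MP] := segment_bounded vr.2.
have := midpoint_rem_littleo b vC ltr01.
set C := _ * cdcoef _ => H; exists (1 + `|C| * M).
apply: filterS2 (@nbhs_right_gt R 0) H => k k0 {}H N n NT pn nN.
have {}H := H N n NT pn nN.
set S := (X in _ - X) in H.
rewrite -(subrK S (midpoint_rem _ _ _ _ _ _ _)) (le_trans (ler_normD _ _))//.
rewrite mulrDl lerD// /S normrZ normrM -mulrA -[leRHS]mulrA ler_wpM2l//.
rewrite mulrC gtr0_norm ?exprn_gt0// ler_wpM2r ?exprn_ge0 ?(ltW k0)// MP//.
rewrite in_itv/= -NT /t_half /t_ ?mulr_ge0 ?(ltW k0)//= ler_pM2r//.
have : (n%:R + 1 : R) <= N%:R by rewrite natr1 ler_nat; lia.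
lra.
Qed.

End remainders.

(** * Explicit coefficients and conclusion *)

Lemma cfact_even_0 (R : realType) n :
  (cfact n.*2).[0] = \prod_(i < n) - ((2 * i + 1)%:R / 2) ^+ 2 :> R.
Proof.
elim: n => [|n IH]; first by rewrite horner_cfact !big_ord0.
by rewrite doubleS cfactSS_0 IH big_ord_recr /= mulrC addn1 mul2n.
Qed.

Theorem theorem5 (R : realType) (X : completeNormedModType R) :
  exists c : nat -> R,
    (forall p : nat, (0 < p)%N ->
       (forall (T : R) (u : R -> X),
          0 < T -> continuously_derivable (2 * p + 3) T u ->
          grid_bigO p T (2 * p + 2) (rem_derivative c p T u) /\
          grid_bigO p T (2 * p + 2) (rem_value c p T u)) /\
       is_error_constant p (2 * p + 2) (2 * p + 3) (2 * p + 3)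
         (@rem_derivative R X c p) (c (2 * p + 3)%N) /\
       is_error_constant p (2 * p + 2) (2 * p + 2) (2 * p + 3)
         (@rem_value R X c p) (c (2 * p + 2)%N)) /\
    [/\ c 2%N = 1 / 8, c 3%N = 1 / 24,
        c 4%N = - (18 / (4`!%:R * 2 ^+ 5)),
        c 5%N = - (18 / (5`!%:R * 2 ^+ 5)) &
        c 6%N = 450 / (6`!%:R * 2 ^+ 7)] /\
    [/\ c 7%N = 450 / (7`!%:R * 2 ^+ 7),
        c 8%N = - (22050%N%:R / (8`!%:R * 2 ^+ 9)),
        c 9%N = - (22050%N%:R / (9`!%:R * 2 ^+ 9)),
        c 10%N = 1786050%N%:R / (10`!%:R * 2 ^+ 11) &
        c 11%N = 1786050%N%:R / (11`!%:R * 2 ^+ 11)].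
Proof.
exists cdcoef; split.
  move=> p _; split=> [T u _ uC|].
    by split; [exact: (midpoint_rem_bigO true)
              |exact: (midpoint_rem_bigO false)].
  have E (b : bool) :
    is_error_constant p (2 * p + 2) (2 * p + 2 + b) (2 * p + 3)
      (@midpoint_rem R X b cdcoef p) (cdcoef (2 * p + 2 + b)).
    (* The common sign is minus. *)
    by exists true => T u _; exact: midpoint_rem_littleo.
  by split; [have := E true; rewrite -addnA | have := E false; rewrite addn0].
have f0 n : (n`!%:R : R) != 0 by rewrite pnatr_eq0 -lt0n fact_gt0.
(* The indices 2m and 2m + 1 share the same product, hence the same numerator a. *)
have cE n m a : n./2 = m ->
    \prod_(i < m) - ((2 * i + 1)%:R / 2) ^+ 2 = - (a / 2 ^+ (2 * m + 1)) ->
    cdcoef n = a / (n`!%:R * 2 ^+ (2 * m + 1)) :> R.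
  move=> nm P; rewrite /cdcoef cfact_even_0 nm P opprK; field.
  by rewrite f0 expf_neq0.
have PS m : \prod_(i < m.+1) - ((2 * i + 1)%:R / 2) ^+ 2 =
    \prod_(i < m) - ((2 * i + 1)%:R / 2) ^+ 2 *
    - ((2 * m + 1)%:R / 2) ^+ 2 :> R.
  by rewrite big_ord_recr.
have P1 : \prod_(i < 1) - ((2 * i + 1)%:R / 2) ^+ 2 =
    - (2 / 2 ^+ (2 * 1 + 1)) :> R.
  by rewrite PS big_ord0; field.
have P2 : \prod_(i < 2) - ((2 * i + 1)%:R / 2) ^+ 2 =
    - (- 18 / 2 ^+ (2 * 2 + 1)) :> R.
  by rewrite PS P1; field.
have P3 : \prod_(i < 3) - ((2 * i + 1)%:R / 2) ^+ 2 =
    - (450 / 2 ^+ (2 * 3 + 1)) :> R.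
  by rewrite PS P2; field.
have P4 : \prod_(i < 4) - ((2 * i + 1)%:R / 2) ^+ 2 =
    - (- 22050%N%:R / 2 ^+ (2 * 4 + 1)) :> R.
  by rewrite PS P3; field.
have P5 : \prod_(i < 5) - ((2 * i + 1)%:R / 2) ^+ 2 =
    - (1786050%N%:R / 2 ^+ (2 * 5 + 1)) :> R.
  by rewrite PS P4; field.
split; split; rewrite -?mulNr.
- by rewrite (cE 2%N 1%N _ erefl P1) (_ : 2`! = 2)%N//; field.
- by rewrite (cE 3%N 1%N _ erefl P1) (_ : 3`! = 6)%N//; field.
- exact: (cE 4%N 2%N _ erefl P2).
- exact: (cE 5%N 2%N _ erefl P2).
- exact: (cE 6%N 3%N _ erefl P3).
- exact: (cE 7%N 3%N _ erefl P3).
- exact: (cE 8%N 4%N _ erefl P4).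
- exact: (cE 9%N 4%N _ erefl P4).
- exact: (cE 10%N 5%N _ erefl P5).
- exact: (cE 11%N 5%N _ erefl P5).
Qed.
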